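(* Let $N\ge 2$, let $\lambda$ be a fixed constant, and let $F(q,m)=[F_1(q,m),\dots,F_N(q,m)]^T\in\mathbb{R}^{2N}$ be given by $$F_i(q,m)=\sum_{j=1,\,j\ne i}^{N}\frac{m_im_j(q_j-q_i)}{\|q_j-q_i\|^3}+\lambda m_i(q_i-c),\qquad i=1,\dots,N,\qquad c=\frac{\sum_{i=1}^N m_iq_i}{\sum_{i=1}^N m_i}.$$ Let $q_0$ be a central configuration for the mass vector $m_0$ in the sense that $F(q_0,m_0)=0$. Let $$P=\begin{bmatrix} B_1 & 0\\ B_2 & \mathrm{Id}\end{bmatrix}\in\mathbb{R}^{2N\times 2N},$$ where $\begin{bmatrix} B_1\\ B_2\end{bmatrix}$ is a $2N\times 3$ matrix whose columns are the rotation vector $A'(0)q_0$ and two linearly independent translation vectors, $B_1$ is $3\times 3$, $B_2$ is $(2N-3)\times 3$, $\mathrm{Id}$ is the $(2N-3)\times(2N-3)$ identity matrix, and suppose that $P$ is invertible. Then $$P^{-1}\,\mathrm{Jac}(F)|_{(q_0,m_0)}\,P=\begin{bmatrix} 0 & J_1\\ 0 & J_2\end{bmatrix}$$ with $J_2$ a $(2N-3)\times(2N-3)$ matrix.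
   Context: Masses $m=(m_1,\dots,m_N)$ are positive. Positions are $q=(q_1,\dots,q_N)\in\mathbb{R}^{2N}$ with $q_i=(x_i,y_i)^T\in\mathbb{R}^2$, written as a column $(x_1,y_1,\dots,x_N,y_N)^T$, and configurations are collision-free ($q_i\neq q_j$ for $i\ne j$). $\|\cdot\|$ is the Euclidean norm. $\mathrm{Jac}(F)|_{(q_0,m_0)}$ is the $2N\times 2N$ Jacobian matrix of $F$ with respect to $q$ ($\lambda$ held constant, $c$ regarded as a function of $q$), evaluated at $(q_0,m_0)$. If $F(q_0,m_0)=0$ then necessarily $\lambda=U(q_0,m_0)/I(q_0,m_0)$, where $U=\sum_{i<j}m_im_j/\|q_i-q_j\|$ and $I=\sum_i m_i\|q_i-c\|^2$. Let $A(t)=\begin{bmatrix}\cos t&-\sin t\\ \sin t&\cos t\end{bmatrix}$ act diagonally on $\mathbb{R}^{2N}$ by $A(t)q=(A(t)q_1,\dots,A(t)q_N)$; thus, for $q_0=(x_{10},y_{10},\dots,x_{N0},y_{N0})^T$, $A'(0)q_0=(-y_{10},x_{10},\dots,-y_{N0},x_{N0})^T$. A translation vector is a vector of the form $(v_x,v_y,v_x,v_y,\dots,v_x,v_y)^T\in\mathbb{R}^{2N}$. A typical choice of the three columns is $(1,0,1,0,\dots,1,0)^T$, $(0,1,0,1,\dots,0,1)^T$, $A'(0)q_0$. *)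

(* Defs.v *)
From mathcomp Require Import all_boot all_order all_algebra.
From mathcomp Require Import all_classical all_reals all_analysis.

Set Implicit Arguments.
Unset Strict Implicit.
Unset Printing Implicit Defensive.

Import Order.TTheory GRing.Theory Num.Theory.
Import numFieldNormedType.Exports.

Local Open Scope ring_scope.

Section PlanarNBody.
Context {R : realType} {N : nat}.

(* Coordinates of 'cV[R]_(N * 2) are ordered (x_1, y_1, ..., x_N, y_N), the
   row-major order of mxvec on N x 2 matrices. *)
Definition stack (u : 'I_N -> 'cV[R]_2) : 'cV[R]_(N * 2) :=
  (mxvec (\matrix_(i < N, k < 2) u i k 0))^T.

Definition body (q : 'cV[R]_(N * 2)) (i : 'I_N) : 'cV[R]_2 :=
  (row i (vec_mx q^T))^T.

(* The library norm on matrices is the sup norm, not the Euclidean one. *)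
Definition euclidean_norm (v : 'cV[R]_2) : R :=
  Num.sqrt (\sum_(k < 2) v k 0 ^+ 2).

Definition collision_free (q : 'cV[R]_(N * 2)) : Prop :=
  forall i j : 'I_N, i != j -> body q i != body q j.

Definition center_of_mass (m : 'I_N -> R) (q : 'cV[R]_(N * 2)) : 'cV[R]_2 :=
  (\sum_(i < N) m i)^-1 *: \sum_(i < N) m i *: body q i.

Definition F (lambda : R) (q : 'cV[R]_(N * 2)) (m : 'I_N -> R) :
    'cV[R]_(N * 2) :=
  stack (fun i =>
    \sum_(j < N | j != i)
      (m i * m j / euclidean_norm (body q j - body q i) ^+ 3)
        *: (body q j - body q i)
    + (lambda * m i) *: (body q i - center_of_mass m q)).

Definition rotation_matrix (t : R) : 'M[R]_2 :=
  \matrix_(i < 2, j < 2)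
    (if i == j then cos t else if i == 0 then - sin t else sin t).

Definition diagonal_action (A : 'M[R]_2) (q : 'cV[R]_(N * 2)) :
    'cV[R]_(N * 2) :=
  stack (fun i => A *m body q i).

Definition rotation_vector (q : 'cV[R]_(N * 2)) : 'cV[R]_(N * 2) :=
  diagonal_action (derive1 rotation_matrix 0) q.

Definition translation_vector (u : 'cV[R]_(N * 2)) : Prop :=
  exists v : 'cV[R]_2, u = stack (fun=> v).

End PlanarNBody.

(* The library Jacobian 'J acts on row vectors from the right, so it is the
   transpose of the matrix of partial derivatives (d G_r / d q_s)_(r, s). *)
Definition Jac {R : realType} {n : nat} (G : 'cV[R]_n -> 'cV[R]_n)
    (q : 'cV[R]_n) : 'M[R]_n :=
  ('J (fun v : 'rV[R]_n => (G v^T)^T) q^T)^T.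

Lemma dim_split (N : nat) : (2 <= N)%N -> (3 + (N * 2 - 3) = N * 2)%N.
Proof. by move=> N2; rewrite subnKC// (leq_trans _ (leq_mul N2 (leqnn 2))). Qed.

Lemma body_stack {R : realType} {N : nat} (u : 'I_N -> 'cV[R]_2) (i : 'I_N) :
  body (stack u) i = u i.
Proof.
by apply/matrixP => k l; rewrite /body /stack trmxK mxvecK !mxE (ord1 l).
Qed.

Lemma body_rotation_vector {R : realType} {N : nat} (q : 'cV[R]_(N * 2))
    (i : 'I_N) :
  body (rotation_vector q) i =
  \col_(k < 2) (if k == 0 then - body q i 1 0 else body q i 0 0).
Proof.
have dA : derive1 (@rotation_matrix R) 0 =
    \matrix_(k < 2, l < 2) (if k == l then 0 else if k == 0 then -1 else 1).
  rewrite derive1E derive_mx; last first.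
    apply/derivable_mxP => k l; rewrite /rotation_matrix.
    under eq_fun do rewrite mxE.
    by case: (k == l); [|case: (k == 0)]; exact: ex_derive.
  apply/matrixP => k l; rewrite !mxE.
  under eq_fun do rewrite mxE.
  case: (k == l); first by rewrite derive_val sin0 oppr0.
  case: (k == 0); last by rewrite derive_val cos0.
  by rewrite derive_val cos0.
rewrite /rotation_vector /diagonal_action body_stack dA.
apply/matrixP => k l; rewrite (ord1 l) !mxE !big_ord_recl big_ord0 !mxE.
rewrite (_ : lift ord0 ord0 = 1); last exact: val_inj.
case: k => [[|[|//]] ?] /=;
  by rewrite !(mul0r, mulN1r, mul1r, add0r, addr0).
Qed.

(* Main.v *)
Require Import Defs.
From mathcomp Require Import all_boot all_order all_algebra.
From mathcomp Require Import all_classical all_reals all_analysis ring.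

Set Implicit Arguments.
Unset Strict Implicit.
Unset Printing Implicit Defensive.

Import Order.TTheory GRing.Theory Num.Theory.
Import numFieldNormedType.Exports.

Local Open Scope ring_scope.

(* A translated copy of a central configuration and a rotated copy A(t) q0 are
   again zeros of F, since F is invariant under translations (the center of
   mass moves along) and equivariant under rotations.  Differentiating
   F (c t) = 0 along these two kinds of curves shows that Jac F annihilates the
   translation vectors and A'(0) q0, i.e. the first three columns of P. *)

(** * Calculus and linear algebra independent of the N-body problem *)

Section Differentiability.
Context {R : realType} {V : normedModType R}.

Lemma differentiable_bigsum (I : finType) (p : pred I) (W : normedModType R)
    (f : I -> V -> W) (x : V) :
  (forall i, p i -> differentiable (f i) x) ->
  differentiable (fun v => \sum_(i | p i) f i v) x.
Proof.
move=> df; rewrite -fct_sumE.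
by elim/big_ind : _ => // g h; exact: differentiableD.
Qed.

Lemma differentiable_rV (n : nat) (f : V -> 'rV[R]_n) (x : V) :
  (forall j, differentiable (fun v => f v 0 j) x) -> differentiable f x.
Proof.
move=> df; under [f]funext => v do rewrite [f v]row_sum_delta.
by apply: differentiable_bigsum => j _; exact: differentiableZl.
Qed.

Lemma differentiable_expr (f : V -> R) (n : nat) (x : V) :
  differentiable f x -> differentiable (fun v => f v ^+ n) x.
Proof.
move=> df; elim: n => [|n IHn]; first exact: differentiable_cst.
by under eq_fun do rewrite exprS; exact: differentiableM.
Qed.

Lemma differentiable_sqrt (f : V -> R) (x : V) :
  differentiable f x -> 0 < f x -> differentiable (fun v => Num.sqrt (f v)) x.
Proof.
move=> df fx0; apply: (differentiable_comp df).
by apply/derivable1_diffP; have [] := is_derive1_sqrt fx0.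
Qed.

End Differentiability.

(** Chain rule: [w] is the velocity of [c] at 0, and the composite of [G] with [c] is constant, so
    its differential at 0 vanishes. The transposes pass to row vectors, on which the library
    Jacobian acts. *)
Lemma Jac_mul_velocity (R : realType) (n : nat) (G : 'cV[R]_n -> 'cV[R]_n)
    (c : R -> 'cV[R]_n) (w : 'cV[R]_n) :
  differentiable (fun v : 'rV[R]_n => (G v^T)^T) (c 0)^T ->
  (forall j, is_derive (0 : R) (1 : R) (fun t : R => c t j 0) (w j 0)) ->
  (forall t, G (c t) = 0) ->
  Jac G (c 0) *m w = 0.
Proof.
move=> dG dc Gc; pose cT t := (c t)^T; pose GT := fun v : 'rV[R]_n => (G v^T)^T.
have dcT : derivable cT 0 1.
  apply/derivable_mxP => i j; rewrite (ord1 i); under eq_fun do rewrite mxE.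
  by have [] := dc j.
have cT'E : 'D_1 cT 0 = w^T.
  rewrite derive_mx//; apply/matrixP => i j; rewrite (ord1 i) !mxE.
  under eq_fun do rewrite mxE.
  by have [] := dc j.
have /derivable1_diffP dcT' := dcT.
apply: trmx_inj; rewrite trmx_mul trmxK trmx0 -cT'E (deriveE _ dcT').
rewrite /jacobian mul_rV_lin1 -/(cT 0).
have /(congr1 (@^~ 1)) /= <- := diff_comp dcT' (dG : differentiable GT (cT 0)).
rewrite (_ : GT \o cT = cst 0) ?diff_cst//.
by apply/funext => t; rewrite /GT /cT /= trmxK Gc trmx0.
Qed.

(** [M *m P] already has zero first [p] columns, and left multiplication by [invmx P] keeps them
    zero. Keeping [n] general lets [e] be eliminated, so that the casts disappear. *)
Lemma invmx_conj_block (R : comUnitRingType) (n p k : nat) (e : (p + k = n)%N)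
    (M P : 'M[R]_n) (B1 : 'M[R]_p) (B2 : 'M[R]_(k, p)) :
  P = castmx (e, e) (block_mx B1 0 B2 1%:M) ->
  M *m castmx (e, erefl) (col_mx B1 B2) = 0 ->
  exists (J1 : 'M[R]_(p, k)) (J2 : 'M[R]_k),
    invmx P *m M *m P = castmx (e, e) (block_mx 0 J1 0 J2).
Proof.
case: n / e M P => M P; rewrite !castmx_id => PE MB.
(* [col_mx 0 1%:M] is the right block column of [P], so [J] is the right block column of the
   conjugate. *)
pose J := invmx P *m (M *m col_mx 0 1%:M).
exists (usubmx J), (dsubmx J).
rewrite castmx_id -mulmxA [in M *m P]PE block_mxEh mul_mx_row MB mul_mx_row.
by rewrite mulmx0 block_mxEh vsubmxK col_mx0.
Qed.

(** * Coordinates and the symmetries of [F] *)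

Section PlanarNBody.
Context {R : realType} {N : nat}.
Implicit Types (q : 'cV[R]_(N * 2)) (m : 'I_N -> R) (v : 'cV[R]_2).

Lemma stackE (u : 'I_N -> 'cV[R]_2) (i : 'I_N) (k : 'I_2) (l : 'I_1) :
  stack u (mxvec_index i k) l = u i k 0.
Proof. by rewrite (ord1 l) mxE mxvecE mxE. Qed.

Lemma bodyE q (i : 'I_N) (k : 'I_2) (l : 'I_1) :
  body q i k l = q (mxvec_index i k) 0.
Proof. by rewrite !mxE. Qed.

Lemma body_inj q q' : body q =1 body q' -> q = q'.
Proof.
move=> qq'; apply/matrixP => j l; case/mxvec_indexP: j => i k.
by rewrite (ord1 l) -!(bodyE _ _ _ 0) qq'.
Qed.

Lemma bodyD q q' (i : 'I_N) : body (q + q') i = body q i + body q' i.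
Proof. by apply/matrixP => k l; rewrite !mxE. Qed.

Lemma euclidean_norm_gt0 v : v != 0 -> 0 < euclidean_norm v.
Proof.
move=> v0; rewrite sqrtr_gt0 lt0r sumr_ge0 => [|k _]; last exact: sqr_ge0.
rewrite andbT; apply: contra v0 => /eqP /psumr_eq0P v0; apply/eqP/matrixP => k l.
rewrite (ord1 l) mxE; apply/eqP; rewrite -sqrf_eq0; apply/eqP.
by apply: v0 => // *; exact: sqr_ge0.
Qed.

Lemma center_of_mass_translate m q v : \sum_(i < N) m i != 0 ->
  center_of_mass m (q + stack (fun=> v)) = center_of_mass m q + v.
Proof.
move=> m0; rewrite /center_of_mass.
under [X in _ *: X = _]eq_bigr do rewrite bodyD body_stack scalerDr.
by rewrite big_split scalerDr -scaler_suml scalerA mulVf// scale1r.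
Qed.

Lemma center_of_mass_diagonal_action m (A : 'M[R]_2) q :
  center_of_mass m (diagonal_action A q) = A *m center_of_mass m q.
Proof.
rewrite /center_of_mass -scalemxAr mulmx_sumr.
by under [X in _ *: X = _]eq_bigr do rewrite body_stack scalemxAr.
Qed.

(** Only differences of positions, and positions relative to the center of mass, enter [F]. *)
Lemma F_translate lambda m q v : \sum_(i < N) m i != 0 ->
  F lambda (q + stack (fun=> v)) m = F lambda q m.
Proof.
move=> m0; apply: body_inj => i; rewrite !body_stack.
have subDr (x y : 'cV[R]_2) : x + v - (y + v) = x - y.
  by rewrite opprD addrACA subrr addr0.
rewrite center_of_mass_translate// bodyD body_stack subDr.
by congr (_ + _); apply: eq_bigr => j _; rewrite bodyD body_stack subDr.
Qed.

(** A norm-preserving [A] leaves the scalar coefficients unchanged; everything else is linear in the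
    positions. *)
Lemma F_diagonal_action lambda m (A : 'M[R]_2) q :
  (forall v, euclidean_norm (A *m v) = euclidean_norm v) ->
  F lambda (diagonal_action A q) m = diagonal_action A (F lambda q m).
Proof.
move=> AE; apply: body_inj => i; rewrite !body_stack mulmxDr.
rewrite center_of_mass_diagonal_action -mulmxBr -scalemxAr mulmx_sumr.
congr (_ + _); apply: eq_bigr => j _.
by rewrite body_stack -mulmxBr AE scalemxAr.
Qed.

(** Splits the rotation into cos t times [v] plus sin t times its quarter turn, which makes the
    velocity at [t = 0] visible. *)
Lemma rotation_matrixE (t : R) v :
  rotation_matrix t *m v = \col_(k < 2)
    (cos t * v k 0 + sin t * (if k == 0 then - v 1 0 else v 0 0)).
Proof.
apply/matrixP => k l; rewrite (ord1 l) !mxE !big_ord_recl big_ord0 !mxE.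
rewrite (_ : lift ord0 ord0 = 1); last exact: val_inj.
case: k => [[|[|//]] ?]; rewrite /= addr0.
  by rewrite mulNr mulrN; congr (_ * v _ _ - _); exact: val_inj.
by rewrite addrC; congr (_ * v _ _ + _); exact: val_inj.
Qed.

Lemma euclidean_norm_rotation (t : R) v :
  euclidean_norm (rotation_matrix t *m v) = euclidean_norm v.
Proof.
congr Num.sqrt; rewrite rotation_matrixE !big_ord_recl !big_ord0 !mxE.
rewrite (_ : lift ord0 ord0 = 1); last exact: val_inj.
rewrite /= !addr0 !sqrrD !exprMn sqrrN.
set a := v _ _; set b := v _ _.
have := cos2Dsin2 t; move: (cos t) (sin t) => c s cs.
(* The two-square identity. *)
transitivity ((c ^+ 2 + s ^+ 2) * (a ^+ 2 + b ^+ 2)); first ring.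
by rewrite cs mul1r.
Qed.

(** * Differentiability of [F] and the kernel of its Jacobian *)

Lemma differentiable_F lambda m q : collision_free q ->
  differentiable (fun v : 'rV[R]_(N * 2) => (F lambda v^T m)^T) q^T.
Proof.
move=> hq.
have dbody i k : differentiable (fun v : 'rV[R]_(N * 2) => body v^T i k 0) q^T.
  by under eq_fun do rewrite bodyE mxE; exact: differentiable_coord.
have dsub i j k : differentiable
    (fun v : 'rV[R]_(N * 2) => (body v^T j - body v^T i) k 0) q^T.
  under eq_fun do rewrite mxE [X in _ + X]mxE.
  exact: differentiableB.
apply: differentiable_rV => j; case/mxvec_indexP: j => i k.
under eq_fun do rewrite mxE stackE mxE summxE.
apply: differentiableD.
- apply: differentiable_bigsum => j ji; under eq_fun do rewrite mxE.
  apply: differentiableM => //; apply: differentiableM => //.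
  (* Absence of collisions makes both the inverse and the square root differentiable at [q]. *)
  have norm_gt0 : 0 < euclidean_norm (body q j - body q i).
    by rewrite euclidean_norm_gt0// subr_eq0 hq.
  apply: differentiableV; last by rewrite trmxK expf_neq0// gt_eqF.
  apply: differentiable_expr; apply: differentiable_sqrt.
    by apply: differentiable_bigsum => l _; exact: differentiable_expr.
  by rewrite -sqrtr_gt0 trmxK.
- under eq_fun do rewrite mxE [X in _ * X]mxE [X in _ * (_ + X)]mxE.
  apply: differentiableM => //; apply: differentiableB => //.
  under eq_fun do rewrite mxE summxE; apply: differentiableM => //.
  apply: differentiable_bigsum => l _; under eq_fun do rewrite mxE.
  exact: differentiableM.
Qed.

Lemma Jac_F_translation lambda m q (u : 'cV[R]_(N * 2)) :
  \sum_(i < N) m i != 0 -> collision_free q -> F lambda q m = 0 ->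
  translation_vector u -> Jac (fun q => F lambda q m) q *m u = 0.
Proof.
move=> m0 hq Fq [v ->]; set u' := stack _.
(* The line through [q] with constant velocity [stack (fun=> v)]. *)
pose c (t : R) := q + stack (fun=> t *: v).
have c0 : c 0 = q.
  by apply: body_inj => i; rewrite bodyD body_stack scale0r addr0.
rewrite -{1}c0; apply: Jac_mul_velocity => [|j|t].
- by rewrite c0; exact: differentiable_F.
- case/mxvec_indexP: j => i k; rewrite stackE.
  under eq_fun do rewrite mxE stackE mxE.
  have dtv : is_derive (0 : R) (1 : R) (fun t : R => t * v k 0) (v k 0).
    by apply: is_derive_eq; rewrite scaler0 add0r [_%:A]mulr1.
  have := is_deriveD (is_derive_cst (q (mxvec_index i k) 0) (0 : R) (1 : R)) dtv.
  by rewrite add0r.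
- by rewrite F_translate.
Qed.

Lemma Jac_F_rotation lambda m q :
  collision_free q -> F lambda q m = 0 ->
  Jac (fun q => F lambda q m) q *m rotation_vector q = 0.
Proof.
move=> hq Fq; pose c (t : R) := diagonal_action (rotation_matrix t) q.
have c0 : c 0 = q.
  apply: body_inj => i; rewrite body_stack rotation_matrixE.
  apply/matrixP => k l; rewrite (ord1 l) mxE cos0 sin0.
  by rewrite mul1r mul0r addr0.
(* Only the base point of [Jac] becomes [c 0]; the [q] inside [rotation_vector q] stays, as the
   velocity of [c] at 0. *)
rewrite -{1}c0; apply: Jac_mul_velocity => [|j|t].
- by rewrite c0; exact: differentiable_F.
- case/mxvec_indexP: j => i k; rewrite -(bodyE _ _ _ 0) body_rotation_vector.
  under eq_fun do rewrite stackE rotation_matrixE mxE.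
  apply: is_derive_eq.
  by rewrite [RHS]mxE cos0 sin0 oppr0 !scaler0 !add0r [_%:A]mulr1.
(* Equivariance turns F(A(t)q) into A(t)F(q) = A(t)0 = 0. *)
- rewrite F_diagonal_action ?Fq; last exact: euclidean_norm_rotation.
  apply: body_inj => i; rewrite body_stack.
  by apply/matrixP => k l; rewrite !mxE big1// => ? _; rewrite !mxE mulr0.
Qed.

End PlanarNBody.

Theorem proposition3p9 (R : realType) (N : nat) (hN : (2 <= N)%N)
    (lambda : R) (m0 : 'I_N -> R) (q0 : 'cV[R]_(N * 2))
    (hm0 : forall i : 'I_N, 0 < m0 i)
    (hq0 : collision_free q0)
    (hF : F lambda q0 m0 = 0)
    (B1 : 'M[R]_(3, 3)) (B2 : 'M[R]_(N * 2 - 3, 3))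
    (t1 t2 : 'cV[R]_(N * 2))
    (ht1 : translation_vector t1) (ht2 : translation_vector t2)
    (ht : free [:: t1; t2])
    (* the columns of [B1; B2] are these three vectors, in any order *)
    (hB : perm_eq
      [seq col k (castmx (dim_split hN, erefl) (col_mx B1 B2)) | k <- enum 'I_3]
      [:: rotation_vector q0; t1; t2])
    (P : 'M[R]_(N * 2))
    (hP : P = castmx (dim_split hN, dim_split hN) (block_mx B1 0 B2 1%:M))
    (hPinv : P \in unitmx) :
  exists (J1 : 'M[R]_(3, N * 2 - 3)) (J2 : 'M[R]_(N * 2 - 3)),
    invmx P *m Jac (fun q => F lambda q m0) q0 *m P =
    castmx (dim_split hN, dim_split hN) (block_mx 0 J1 0 J2).
Proof.
apply: invmx_conj_block hP _; set C := castmx _ _ in hB *.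
(* A sum of nonnegative terms with a positive one, that of index 0, which exists as N is at least
   2. *)
have m0_neq0 : \sum_(i < N) m0 i != 0.
  rewrite psumr_neq0 => [|i _]; last exact: ltW.
  by apply/hasP; exists (Ordinal (ltnW hN)); rewrite ?mem_index_enum//= hm0.
(* Arguing column by column makes the order of the three vectors irrelevant: [hB] is used only
   through membership. *)
suff JC k : Jac (fun q => F lambda q m0) q0 *m col k C = 0.
  apply/matrixP => i k; have /colP/(_ i) := JC k.
  by rewrite colE mulmxA -colE [LHS]mxE [RHS]mxE => ->; rewrite mxE.
have : col k C \in [:: rotation_vector q0; t1; t2].
  by rewrite -(perm_mem hB); apply: map_f; rewrite mem_enum.
rewrite !inE => /or3P[] /eqP ->.
- exact: Jac_F_rotation.
- exact: Jac_F_translation.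
- exact: Jac_F_translation.
Qed.
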